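(* Let $n\ge 1$ and let $\mathbf{c}=(c_1,\dots,c_n)$ be a tuple of positive integers. There is a bijection between the set $\mathcal{R}_C(\mathbf{c})$ of regions of the asymmetric $\mathbf{c}$-Catalan arrangement $\mathcal{A}_{\mathrm{Cat}}^{\mathbf{c}}$ and the set $\mathcal{D}(\mathbf{c})$ of $\mathbf{c}$-labelled Dyck paths.
   Context: Notation: $[n]=\{1,\dots,n\}$; for integers $a\le b$, $[a,b]=\{a,a+1,\dots,b\}$. $C=\sum_{i=1}^n c_i$. For each $i\in[n]$ put $m_i=(c_i+1)/2$ if $c_i$ is odd and $m_i=c_i/2$ if $c_i$ is even. Let $I=\{i\in[n] : c_i \text{ is odd}\}$ and let $\mathbf{1}_I$ be its indicator function ($\mathbf{1}_I(i)=1$ if $i\in I$ and $0$ otherwise). Asymmetric $\mathbf{c}$-Catalan arrangement: the finite collection $\mathcal{A}_{\mathrm{Cat}}^{\mathbf{c}}$ of all affine hyperplanes $\{x\in\mathbb{R}^n : x_i-x_j=k\}$ with $i\ne j$ in $[n]$ and $k\in[-m_i-m_j+\mathbf{1}_I(i),\; m_i+m_j-\mathbf{1}_I(j)]$. A region of a hyperplane arrangement $\mathcal{A}$ in $\mathbb{R}^n$ is a connected component of $\mathbb{R}^n\setminus\bigcup_{H\in\mathcal{A}}H$. A $\mathbf{c}$-labelled Dyck path is a lattice path of $C+n$ steps from $(0,0)$ to $(C+n,0)$ that stays weakly above the $x$-axis and consists of $C$ down steps $D=(1,-1)$ and $n$ up steps, where for some permutation $\pi$ of $[n]$ the $i$-th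 up step (for $1\le i\le n$) is $U_{\pi(i)}=(1,c_{\pi(i)})$. The up steps carry their labels: $U_i$ and $U_j$ are regarded as different steps when $i\neq j$, even if $c_i=c_j$ (so a path is a sequence of symbols in $\{D,U_1,\dots,U_n\}$, each $U_i$ being used exactly once). $\mathcal{D}(\mathbf{c})$ is the set of all $\mathbf{c}$-labelled Dyck paths. *)

(* Defs.v *)
From HB Require Import structures.
From mathcomp Require Import all_boot all_order all_algebra all_fingroup.
From mathcomp Require Import all_classical all_reals all_analysis.
Import Order.TTheory GRing.Theory Num.Theory.
Import numFieldNormedType.Exports.

Set Implicit Arguments.
Unset Strict Implicit.
Unset Printing Implicit Defensive.

Local Open Scope classical_set_scope.
Local Open Scope ring_scope.

(* The index set [n] = {1, ..., n} is represented by 'I_n, and a tuple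
   (c_1, ..., c_n) of natural numbers by a function c : 'I_n -> nat. *)

Section Arrangements.
Variables (R : realType) (n : nat).

Definition hyperplane (i j : 'I_n) (k : int) : set 'rV[R]_n :=
  [set x | x ord0 i - x ord0 j = k%:~R].

Definition arr_complement (A : set (set 'rV[R]_n)) : set 'rV[R]_n :=
  ~` \bigcup_(H in A) H.

Definition regions (A : set (set 'rV[R]_n)) : set (set 'rV[R]_n) :=
  [set connected_component (arr_complement A) x | x in arr_complement A].

End Arrangements.

Section Catalan.
Variables (n : nat) (c : 'I_n -> nat).

Definition csum : nat := (\sum_(i < n) c i)%N.

Definition mhalf (i : 'I_n) : nat :=
  if odd (c i) then (c i).+1./2 else (c i)./2.

Definition oddI : {set 'I_n} := [set i | odd (c i)]%SET.

Definition oneI (i : 'I_n) : int := (i \in oddI)%:Z.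

Definition catalan_arrangement (R : realType) : set (set 'rV[R]_n) :=
  [set H | exists (i j : 'I_n) (k : int),
    [/\ i != j,
        - (mhalf i)%:Z - (mhalf j)%:Z + oneI i <= k,
        k <= (mhalf i)%:Z + (mhalf j)%:Z - oneI j
      & H = hyperplane i j k]].

End Catalan.

Arguments catalan_arrangement {n} c R.

Section DyckPaths.
Variables (n : nat) (c : 'I_n -> nat).

(* None is the down step D, and Some i is the up step U_i. *)
Definition step : Type := option 'I_n.

Definition step_vec (s : step) : int * int :=
  if s is Some i then (1, (c i)%:Z) else (1, -1).

(* The end point of the lattice path that starts at (0, 0) and follows w. *)
Definition endpoint (w : seq step) : int * int := \sum_(s <- w) step_vec s.

Definition labelled_dyck_path (w : seq step) : Prop :=
  [/\ size w = (csum c + n)%N,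
      count_mem None w = csum c,
      exists pi : 'S_n,
        [seq s <- w | s != None] = [seq Some (pi i) | i <- enum 'I_n],
      endpoint w = ((csum c + n)%N%:Z, 0)
    & forall k : nat, 0 <= (endpoint (take k w)).2].

Definition labelled_dyck_paths : set (seq step) := [set w | labelled_dyck_path w].

End DyckPaths.

(* Main.v *)
Require Import Defs.
From HB Require Import structures.
From mathcomp Require Import all_boot all_order all_algebra all_fingroup.
From mathcomp Require Import all_classical all_reals all_analysis.
From mathcomp Require Import zify ring lra.
Import Order.TTheory GRing.Theory Num.Theory.
Import numFieldNormedType.Exports.

(** Put y_i = x_i - m_i and attach to i the c_i + 1 reals y_i, y_i + 1, ...,
    y_i + c_i.  Since c_i = 2 m_i - 1_I(i), the arrangement consists exactly of
    the hyperplanes on which a real attached to i equals one attached to some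
    j <> i, so a region is the same as a strict order on these C + n reals.
    Reading them from left to right, write U_i for y_i and D for all the others.
    A translate by 1 preserves the order, so the reals marked D come in the same
    order as their predecessors: the word determines the order, because each D
    is the successor of the first real whose successor has not been read yet.
    Conversely a Dyck path is realized from left to right: the Dyck condition
    provides such a predecessor for every D, and at U_i the real y_i is chosen
    between the last real placed and the next forced one. *)

(** * Points, their marks and the height of the resulting path *)

Section Points.
Context {n : nat} (c : 'I_n -> nat).
Local Open Scope nat_scope.
Set Implicit Arguments.
Unset Strict Implicit.
Unset Printing Implicit Defensive.
Implicit Types (T : seq ('I_n * nat)) (w : seq (step n)).

(* The pair (i, s) stands for the real y_i + s. *)
Definition points : seq ('I_n * nat) :=
  [seq (i, s) | i <- enum 'I_n, s <- iota 0 (c i).+1].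

Definition mark (p : 'I_n * nat) : step n := if p.2 == 0 then Some p.1 else None.

Definition shifted T : seq ('I_n * nat) := [seq p <- T | p.2 != 0].

(* The points whose down steps are paid for by the up steps of T. *)
Definition budget T : seq ('I_n * nat) :=
  [seq (p.1, s) | p <- [seq p <- T | p.2 == 0], s <- iota 1 (c p.1)].

Definition pred_closed T := forall i s, (i, s.+1) \in T -> (i, s) \in T.

Definition succ_closed T :=
  forall i s, s < c i -> (i, s) \in T -> (i, s.+1) \in T.

Lemma mem_points p : (p \in points) = (p.2 <= c p.1).
Proof.
apply/allpairsPdep/idP => [[i [s [_]]]|le_p].
  by rewrite mem_iota => ? -> /=; lia.
by exists p.1, p.2; rewrite mem_enum mem_iota add0n ltnS; split => //; case: p {le_p}.
Qed.

Lemma points_uniq : uniq points.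
Proof.
apply: allpairs_uniq_dep; first exact: enum_uniq.
  by move=> i _; apply: iota_uniq.
by move=> [i s] [j t] _ _ /= [-> ->].
Qed.

Lemma size_points : size points = csum c + n.
Proof.
rewrite size_allpairs_dep sumnE big_map big_enum /= -[X in _ = _ + X](card_ord n).
by rewrite -sum1_card -big_split /=; apply: eq_bigr => i _; rewrite size_iota addn1.
Qed.

Lemma points_pred_closed : pred_closed points.
Proof. by move=> i s; rewrite !mem_points /=; lia. Qed.

Lemma points_succ_closed : succ_closed points.
Proof. by move=> i s; rewrite !mem_points /=; lia. Qed.

Lemma endpoint_rcons w s :
  endpoint c (rcons w s) = (endpoint c w + step_vec c s)%R.
Proof. by rewrite /endpoint -cats1 big_cat /= big_seq1. Qed.

Lemma endpoint1 w : ((endpoint c w).1 = (size w)%:Z)%R.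
Proof.
elim/last_ind: w => [|w s IH]; first by rewrite /endpoint big_nil.
by rewrite endpoint_rcons size_rcons /= IH; case: s => [i|] /=; lia.
Qed.

(** Each U_i adds c_i, the number of points it contributes to [budget], and each D costs one point
    of [shifted]. Bounds on the height thus reduce to inclusions between these two lists. *)
Lemma endpoint2 T :
  ((endpoint c (map mark T)).2 = (size (budget T))%:Z - (size (shifted T))%:Z)%R.
Proof.
elim/last_ind: T => [|T p IH]; first by rewrite /endpoint big_nil.
rewrite map_rcons endpoint_rcons /= IH /shifted /budget !filter_rcons /mark.
case: eqP => _ /=; last by rewrite size_rcons; lia.
by rewrite !size_allpairs_dep map_rcons sumn_rcons size_iota; lia.
Qed.

Lemma budgetP T p :
  reflect [/\ (p.1, 0) \in T, 0 < p.2 & p.2 <= c p.1] (p \in budget T).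
Proof.
apply: (iffP allpairsPdep) => [[[i t] [s []]]|[p0 gt0 le_p]].
  by rewrite mem_filter mem_iota /= => /andP[/eqP -> ?] ? -> /=; split => //; lia.
exists (p.1, 0), p.2; rewrite mem_filter mem_iota /= p0; split => //; first by rewrite gt0 add1n ltnS.
by case: p {p0 gt0 le_p}.
Qed.

Lemma budget_uniq T : uniq T -> uniq (budget T).
Proof.
move=> uT; apply: allpairs_uniq_dep; first exact: filter_uniq.
  by move=> p _; apply: iota_uniq.
move=> _ _ /allpairsPdep[[i s] [s' [+ _ ->]]] /allpairsPdep[[j t] [t' [+ _ ->]]] /=.
by rewrite !mem_filter /= => /andP[/eqP -> _] /andP[/eqP -> _] [-> ->].
Qed.

Lemma shifted_sub_budget T :
  {subset T <= points} -> pred_closed T -> {subset shifted T <= budget T}.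
Proof.
move=> subT closT [i s]; rewrite mem_filter /= => /andP[s0 isT].
apply/budgetP => /=; split; last 2 first.
- by rewrite lt0n.
- by have := subT _ isT; rewrite mem_points.
by elim: s isT {s0} => // s IH /closT.
Qed.

Lemma budget_sub_shifted T : succ_closed T -> {subset budget T <= shifted T}.
Proof.
move=> closT [i s] /budgetP[/= i0T gt0 le_s]; rewrite mem_filter -lt0n gt0 /=.
by elim: s le_s {gt0} => // s IH le_s; apply: closT => //; apply: IH; lia.
Qed.

Lemma endpoint2_ge0 T : uniq T -> {subset T <= points} -> pred_closed T ->
  (0 <= (endpoint c (map mark T)).2)%R.
Proof.
move=> uT subT closT; rewrite endpoint2 subr_ge0 lez_nat.
by apply: uniq_leq_size; [apply: filter_uniq | apply: shifted_sub_budget].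
Qed.

(** This serves twice: on a rearrangement of [points] it forces the path to end at height 0, and
    contrapositively a positive height means that some point still lacks its successor. *)
Lemma endpoint2_le0 T : uniq T -> succ_closed T ->
  ((endpoint c (map mark T)).2 <= 0)%R.
Proof.
move=> uT closT; rewrite endpoint2 subr_le0 lez_nat.
by apply: uniq_leq_size; [apply: budget_uniq | apply: budget_sub_shifted].
Qed.

Lemma filter_mark T : [seq s <- map mark T | s != None] =
  [seq Some p.1 | p <- T & p.2 == 0].
Proof.
rewrite filter_map (@eq_filter _ _ (fun p => p.2 == 0)) => [|p].
  by apply/eq_in_map => p; rewrite mem_filter /mark => /andP[->].
by rewrite /= /mark; case: (p.2 == 0).
Qed.

Lemma dyck_of_perm T : perm_eq T points ->
  (forall k, pred_closed (take k T)) -> labelled_dyck_path c (map mark T).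
Proof.
move=> permT closT; have uT : uniq T by rewrite (perm_uniq permT) points_uniq.
have memT := perm_mem permT.
have sizeT : size T = csum c + n by rewrite (perm_size permT) size_points.
(* The labels of the up steps in reading order; as a rearrangement of [n], [L] provides the
   permutation [pi]. *)
pose L := [seq p.1 | p <- T & p.2 == 0].
have permL : perm_eq L (ord_tuple n).
  apply: uniq_perm => [||i]; rewrite ?val_ord_tuple.
  - rewrite map_inj_in_uniq; first exact: filter_uniq.
    move=> [i s] [j t].
    by rewrite !mem_filter /= => /andP[/eqP -> _] /andP[/eqP -> _] ->.
  - exact: enum_uniq.
  rewrite mem_enum; apply/mapP; exists (i, 0) => //.
  by rewrite mem_filter memT mem_points.
have filterE : [seq s <- map mark T | s != None] = map Some L.
  by rewrite filter_mark /L -map_comp.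
split; first by rewrite size_map.
- have := count_predC (fun s : step n => s != None) (map mark T).
  rewrite -size_filter filterE (size_map Some) (perm_size permL) size_tuple.
  rewrite size_map sizeT.
  rewrite (@eq_count _ _ (pred1 None)) => [|s /=]; last by rewrite negbK.
  by lia.
- have /tuple_permP[pi Lpi] := permL; exists pi; rewrite filterE Lpi -map_comp.
  by apply: eq_map => i /=; rewrite tnth_ord_tuple.
- rewrite [LHS]surjective_pairing endpoint1 size_map sizeT; congr pair.
  apply: le_anti; rewrite endpoint2_ge0 ?endpoint2_le0 //.
  + by move=> i s; rewrite !memT; apply: points_succ_closed.
  + by move=> p; rewrite memT.
  + by rewrite -(take_size T).
move=> k; rewrite -map_take endpoint2_ge0 ?take_uniq //.
by move=> p /mem_take; rewrite memT.
Qed.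

End Points.

(** * Orders on the points induced by real vectors *)

Section Keys.
Context {R : realType} {n : nat} (c : 'I_n -> nat).
Local Open Scope ring_scope.
Set Implicit Arguments.
Unset Strict Implicit.
Unset Printing Implicit Defensive.
Implicit Types (y z : 'I_n -> R) (T P Q : seq ('I_n * nat)) (w : seq (step n)).

Definition key y (p : 'I_n * nat) : R := y p.1 + p.2%:R.

Definition key_lt y : rel ('I_n * nat) := fun p q => key y p < key y q.

Definition enumerates y P := perm_eq P (points c) /\ pairwise (key_lt y) P.

Definition same_order y z :=
  {in points c &, forall p q, (key y p < key y q) = (key z p < key z q)}.

Lemma keyS y i s : key y (i, s.+1) = key y (i, s) + 1.
Proof. by rewrite /key /= -natr1 addrA. Qed.

(** Positions do not depend on [y], so this transfers comparisons between two real vectors that sort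
    the same list. *)
Lemma pairwise_key_ltE y T : pairwise (key_lt y) T ->
  {in T &, forall p q, (key y p < key y q) = (index p T < index q T)%N}.
Proof.
move=> incT; have trT : transitive (key_lt y) by move=> ? ? ?; apply: lt_trans.
have srtT : sorted (key_lt y) T by rewrite sorted_pairwise.
move=> p q pT qT; apply/idP/idP; last exact: (sorted_ltn_index trT srtT).
case: (ltngtP (index p T) (index q T)) => // [lt_ix lt_pq|/(index_inj p pT qT) ->].
  have := lt_trans lt_pq (sorted_ltn_index trT srtT _ _ qT pT lt_ix).
  by rewrite ltxx.
by rewrite ltxx.
Qed.

Lemma key_inj_of_pairwise y T : pairwise (key_lt y) T -> {in T &, injective (key y)}.
Proof.
move=> incT p q pT qT eq_pq; apply: (@index_inj _ p T) => //.
have := pairwise_key_ltE incT pT qT; have := pairwise_key_ltE incT qT pT.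
by rewrite eq_pq ltxx => /esym + /esym; case: ltngtP.
Qed.

(** Otherwise [p] would lie in [drop k T], and its key would exceed that of [q]. *)
Lemma take_key_down y T k p q : pairwise (key_lt y) T ->
  p \in T -> q \in take k T -> key y p < key y q -> p \in take k T.
Proof.
rewrite -{1 2}(cat_take_drop k T) mem_cat pairwise_cat.
move=> /and3P[/allrelP lt_td _ _] /orP[//|pD] qT lt_pq.
by have := lt_trans lt_pq (lt_td _ _ qT pD); rewrite ltxx.
Qed.

Lemma enumerates_pred_closed y P k : enumerates y P -> pred_closed (take k P).
Proof.
move=> [permP incP] i s isP; apply: (take_key_down incP _ isP); last by rewrite keyS ltrDl.
by have := mem_take isP; rewrite !(perm_mem permP); apply: points_pred_closed.
Qed.

Lemma enumerates_uniq y P : enumerates y P -> uniq P.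
Proof. by move=> [permP _]; rewrite (perm_uniq permP) points_uniq. Qed.

Lemma enumerates_exists y : {in points c &, injective (key y)} ->
  enumerates y (sort (relpre (key y) <=%R) (points c)).
Proof.
move=> injy; set P := sort _ _; have permP : perm_eq P (points c) by rewrite perm_sort.
split=> //; have: sorted <%R (map (key y) P).
  by rewrite -sort_map sort_lt_sorted map_inj_in_uniq // points_uniq.
by rewrite lt_sorted_pairwise pairwise_map.
Qed.

Lemma enumerates_eq y P Q : enumerates y P -> enumerates y Q -> P = Q.
Proof.
move=> [permP incP] [permQ incQ].
have trT : transitive (key_lt y) by move=> ? ? ?; apply: lt_trans.
apply: (@irr_sorted_eq _ (key_lt y)); rewrite ?sorted_pairwise //.
  by move=> p; rewrite /key_lt ltxx.
by move=> p; rewrite (perm_mem permP) (perm_mem permQ).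
Qed.

Lemma enumerates_same_order y z P : enumerates y P -> enumerates z P -> same_order y z.
Proof.
move=> [permP incy] [_ incz] p q; rewrite -!(perm_mem permP) => pP qP.
by rewrite (pairwise_key_ltE incy) // (pairwise_key_ltE incz).
Qed.

Lemma same_order_enumerates y z P : same_order y z -> enumerates y P -> enumerates z P.
Proof.
move=> yz [permP incP]; split=> //; have eq_lt : {in P &, key_lt y =2 key_lt z}.
  by move=> p q pP qP; apply: yz; rewrite -(perm_mem permP).
by rewrite -(eq_in_pairwise eq_lt (allss P)).
Qed.

End Keys.

(** * The word determines the order, and every Dyck path is realized *)

Section Words.
Context {R : realType} {n : nat} (c : 'I_n -> nat).
Local Open Scope ring_scope.
Set Implicit Arguments.
Unset Strict Implicit.
Unset Printing Implicit Defensive.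
Implicit Types (y z : 'I_n -> R) (T P Q : seq ('I_n * nat)) (w : seq (step n)).
(* If p = (i, s+1) and q = (j, t+1) differed, then (i, s) and (j, t) would both lie
   in the common prefix, and the successor of the smaller one as well. *)
Lemma same_key_nth y z k P Q : enumerates c y P -> enumerates c z Q ->
  take k P = take k Q -> (k < size P)%N -> forall p q,
  nth q P k = p -> nth p Q k = q -> mark p = mark q -> p = q.
Proof.
move=> enP enQ eqT ltkP p q Pp Qq; have uP := enumerates_uniq enP.
have sQ : size Q = size P by case: enP enQ => [/perm_size -> _] [/perm_size -> _].
have TP : take k.+1 P = rcons (take k P) p by rewrite (take_nth q) // Pp.
have TQ : take k.+1 Q = rcons (take k Q) q by rewrite (take_nth p) ?sQ // Qq.
have pN : p \notin take k P.
  by have := take_uniq k.+1 uP; rewrite TP rcons_uniq => /andP[].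
have qN : q \notin take k Q.
  by have := take_uniq k.+1 (enumerates_uniq enQ); rewrite TQ rcons_uniq => /andP[].
have pP : p \in take k.+1 P by rewrite TP mem_rcons inE eqxx.
have qQ : q \in take k.+1 Q by rewrite TQ mem_rcons inE eqxx.
have PM := perm_mem enP.1; have QM := perm_mem enQ.1.
(* Two up steps are settled by their labels and the mixed cases contradict the equality of marks;
   only two down steps remain. *)
move: p q {Pp Qq} TP TQ pN qN pP qQ => [i [|s]] [j [|t]] TP TQ pN qN pP qQ //=.
  by case=> ->.
have isT : (i, s) \in take k P.
  have := enumerates_pred_closed enP pP; rewrite TP mem_rcons inE => /orP[/eqP[]|//].
  by lia.
have jtT : (j, t) \in take k P.
  have := enumerates_pred_closed enQ qQ; rewrite TQ eqT mem_rcons inE => /orP[/eqP[]|//].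
  by lia.
have incyT : pairwise (key_lt y) (take k P).
  by have := enP.2; rewrite -{1}(cat_take_drop k P) pairwise_cat => /and3P[].
have inczT : pairwise (key_lt z) (take k P).
  by have := enQ.2; rewrite eqT -{1}(cat_take_drop k Q) pairwise_cat => /and3P[].
have := pairwise_key_ltE incyT isT jtT; have := pairwise_key_ltE inczT isT jtT.
have := pairwise_key_ltE incyT jtT isT.
case: (ltngtP (index (i, s) _) (index (j, t) _)) => [lt_ix _|lt_ix + _ _|eq_ix _ _ _ _].
(* Here (i, s+1) precedes q in the order of z, so it lies in [take k.+1 Q]; as it differs from q, it
   is already in the common prefix. The next case is the mirror image, in the order of y. *)
- move=> ltz _; case/negP: pN; rewrite eqT.
  have: (i, s.+1) \in take k.+1 Q.
    apply: (take_key_down enQ.2 _ qQ); last by rewrite !keyS ltrD2r.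
    by rewrite QM -PM; apply: mem_take pP.
  rewrite TQ mem_rcons inE => /orP[/eqP[ij st]|//].
  by move: lt_ix; rewrite ij st ltnn.
- move=> lty _; case/negP: qN; rewrite -eqT.
  have: (j, t.+1) \in take k.+1 P.
    apply: (take_key_down enP.2 _ pP); last by rewrite !keyS ltrD2r.
    by rewrite PM -QM; apply: mem_take qQ.
  rewrite TP mem_rcons inE => /orP[/eqP[ij st]|//].
  by move: lt_ix; rewrite ij st ltnn.
by have [-> ->] := index_inj (i, s) isT jtT eq_ix.
Qed.

(** The common prefix grows by induction on its length, [same_key_nth] giving the next point. *)
Lemma enumerates_mark_inj y z P Q : enumerates c y P -> enumerates c z Q ->
  map (@mark n) P = map (@mark n) Q -> P = Q.
Proof.
move=> enP enQ eqm.
have sQ : size Q = size P by rewrite -(size_map (@mark n)) -eqm size_map.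
have eqT k : (k <= size P)%N -> take k P = take k Q.
  elim: k => [|k IH] ltk; first by rewrite !take0.
  (* [nth] needs a default point; [P] supplies one, being nonempty since k < [size P]. *)
  have [p0 _] : exists p0, p0 \in P.
    by case: (P) ltk => // p0 P' _; exists p0; rewrite inE eqxx.
  rewrite !(take_nth p0) ?sQ // IH ?(ltnW ltk) //; congr rcons.
  apply: (same_key_nth enP enQ (IH (ltnW ltk)) ltk) => //.
  - exact: set_nth_default.
  - by apply: set_nth_default; rewrite sQ.
  have := congr1 (fun s => nth (mark p0) s k) eqm.
  by rewrite /= !(nth_map p0) ?sQ.
by rewrite -(take_size P) eqT // -sQ take_size.
Qed.

(** The successors of these points are the reals already forced but not yet placed; the first point
    in this list yields the next D. *)
Definition pending T := [seq p <- T | (p.2 < c p.1)%N && ((p.1, p.2.+1) \notin T)].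

(* The last clause leaves room for a further real: all reals placed so far are
   smaller than every real that is already forced but not yet placed. *)
Definition realizes y T :=
  [/\ pairwise (key_lt y) T, {subset T <= points c}, pred_closed T &
      {in T & pending T, forall p q, key y p < key y q + 1}].

Lemma realizes_eq y z T : {in T, key y =1 key z} -> realizes y T -> realizes z T.
Proof.
move=> yz [incT subT closT pendT].
have eq_lt : {in T &, key_lt y =2 key_lt z}.
  by move=> p q pT qT; rewrite /key_lt !yz.
split=> // [|p q pT qT]; first by rewrite -(eq_in_pairwise eq_lt (allss T)).
by rewrite -!yz ?pendT //; move: qT; rewrite mem_filter => /andP[].
Qed.

(** A pending point of the longer list is either [p] itself or an old pending point whose successor
    is not [p]; the hypotheses on keys cover exactly these. *)
Lemma realizes_rcons y T p : realizes y T -> p \in points c ->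
  (forall s, p.2 = s.+1 -> (p.1, s) \in T) ->
  {in T, forall q, key y q < key y p} ->
  {in pending T, forall q, (q.1, q.2.+1) != p -> key y p < key y q + 1} ->
  realizes y (rcons T p).
Proof.
move=> [incT subT closT pendT] pp predp ltTp ltp; split.
- by rewrite pairwise_rcons incT andbT; apply/allP.
- by move=> q; rewrite mem_rcons inE => /orP[/eqP ->|/subT].
- move=> i s; rewrite !mem_rcons !inE => /orP[/eqP ep|/closT ->]; last by rewrite orbT.
  by move: predp; rewrite -ep /= => ->; rewrite ?orbT.
move=> q r qT; rewrite mem_filter !mem_rcons !inE negb_or.
move=> /andP[/and3P[ltr np nT] /orP[/eqP ->|rT]].
  by move: qT; rewrite mem_rcons inE => /orP[/eqP ->|/ltTp]; lra.
have rp : r \in pending T by rewrite mem_filter ltr nT.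
by move: qT; rewrite mem_rcons inE => /orP[/eqP ->|/pendT]; [apply: ltp|apply].
Qed.

(** With nothing pending, [T] would be closed under successors and the height at most 0. Otherwise
    the first pending point has the smallest key, so its successor is the least forced real and may
    come next; [y] is kept. *)
Lemma realizes_down y T : realizes y T -> uniq T ->
  0 < (endpoint c (map (@mark n) T)).2 ->
  exists p, realizes y (rcons T p) /\ mark p = None.
Proof.
move=> rT uT; have [incT subT closT pendT] := rT.
have incP : pairwise (key_lt y) (pending T) by apply: pairwise_filter.
case eP: (pending T) incP => [|[i s] L] /= => [_|/andP[/allP ltL _] _].
  rewrite ltNge endpoint2_le0 // => i s lts isT; apply/negPn/negP => isN.
  by have : (i, s) \in pending T; [rewrite mem_filter lts isN | rewrite eP].
have isP : (i, s) \in pending T by rewrite eP inE eqxx.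
have := isP; rewrite mem_filter => /andP[/andP[lts isN] isT].
exists (i, s.+1); split=> //; apply: realizes_rcons => //.
- by rewrite mem_points.
- by move=> t [<-].
- by move=> q qT; rewrite keyS pendT.
move=> q; rewrite eP inE keyS ltrD2r => /orP[/eqP ->|/ltL //].
by rewrite eqxx.
Qed.

(** By closure under predecessors no point labelled [i] is in [T], so the value of [y] at [i] can be
    changed without moving any real placed so far. *)
Lemma realizes_up y T i : realizes y T -> (i, 0%N) \notin T ->
  exists z, realizes z (rcons T (i, 0%N)).
Proof.
move=> rT i0T; have [incT subT closT pendT] := rT.
have iT s : (i, s) \notin T by elim: s => // s; apply: contra => /closT.
have [v [ltTv ltvP]] : exists v,
    {in T, forall p, key y p < v} /\ {in pending T, forall p, v < key y p + 1}.
  (* The last point [q] carries the largest placed real, and the first pending point, if any, gives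
     the least forced one; [v] is then their midpoint. *)
  case/lastP: T incT pendT {rT i0T subT closT iT} => [|T q]; first by exists 0.
  rewrite pairwise_rcons => /andP[/allP ltTq incT] pendT.
  have leq p : p \in rcons T q -> key y p <= key y q.
    by rewrite mem_rcons inE => /orP[/eqP ->//|/ltTq /ltW].
  have incP : pairwise (key_lt y) (pending (rcons T q)).
    by apply: pairwise_filter; rewrite pairwise_rcons incT andbT; apply/allP.
  have qT : q \in rcons T q by rewrite mem_rcons inE eqxx.
  case eP: (pending _) incP => [|p L] /= => [_|/andP[/allP ltL _]].
    by exists (key y q + 1); split=> // p /leq; lra.
  have := pendT q p qT; rewrite eP inE eqxx => /(_ isT) ltqp.
  exists ((key y q + key y p + 1) / 2); split=> [r /leq|r]; first by lra.
  by rewrite inE => /orP[/eqP ->|/ltL]; rewrite ?/key_lt; lra.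
pose z j := if j == i then v else y j; exists z.
have yz : {in T, key y =1 key z}.
  move=> [j s] jsT; rewrite /key /z /=; case: eqP => // ji.
  by have := iT s; rewrite -ji jsT.
have zi : key z (i, 0%N) = v by rewrite /key /z /= eqxx addr0.
apply: realizes_rcons => //; first exact: realizes_eq rT.
- by rewrite mem_points.
- by move=> q qT; rewrite zi -yz ?ltTv.
move=> q qP _; rewrite zi -yz ?ltvP //.
by move: qP; rewrite mem_filter => /andP[].
Qed.

Lemma realizes_exists w : uniq [seq s <- w | s != None] ->
  (forall k, 0 <= (endpoint c (take k w)).2) ->
  exists y T, realizes y T /\ map (@mark n) T = w.
Proof.
elim/last_ind: w => [|w s IH] uw pos; first by exists (fun=> 0), [::].
have uw' : uniq [seq s <- w | s != None].
  by move: uw; rewrite filter_rcons; case: (s != None); rewrite ?rcons_uniq => // /andP[].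
have [k|y [T [rT Tw]]] := IH uw'.
  have [lek|/ltnW lek] := leqP k (size w).
    by have := pos k; rewrite -cats1 takel_cat.
  by have := pos (size w); rewrite -cats1 take_size_cat // take_oversize.
have [incT subT closT pendT] := rT.
have uT : uniq T.
  by apply: (pairwise_uniq _ incT) => p; rewrite /key_lt ltxx.
case: s uw pos => [i|] uw pos.
  have [|z rz] := realizes_up (i := i) rT.
    move: uw; rewrite filter_rcons /= rcons_uniq mem_filter /= => /andP[+ _].
    by apply: contra => /(map_f (@mark n)); rewrite Tw.
  by exists z, (rcons T (i, 0%N)); rewrite map_rcons Tw.
(* The height after this D is nonnegative, so the height before it is positive. *)
have [|p [rp mp]] := realizes_down rT uT.
  have := pos (size w).+1; rewrite take_oversize ?size_rcons //.
  by rewrite endpoint_rcons Tw /=; lia.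
by exists y, (rcons T p); rewrite map_rcons Tw mp.
Qed.

(** The realized list is duplicate-free, lies in [points] and has the same size, so it exhausts
    [points]. *)
Lemma dyck_enumerated w : labelled_dyck_path c w ->
  exists y P, enumerates c y P /\ map (@mark n) P = w.
Proof.
move=> [sw _ [pi fw] _ pos].
have [|y [P [[incP subP _ _] Pw]]] := realizes_exists _ pos.
  rewrite fw map_inj_uniq ?enum_uniq // => i j [/perm_inj //].
exists y, P; split=> //; split=> //.
have uP : uniq P by apply: (pairwise_uniq _ incP) => p; rewrite /key_lt ltxx.
apply: uniq_perm => //; first exact: points_uniq.
by have [|_ //] := uniq_min_size uP subP; rewrite size_points -sw -Pw size_map.
Qed.

End Words.

(** * Regions correspond to orders on the points *)

Section Regions.
Context {R : realType} {n : nat} (c : 'I_n -> nat).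
Local Open Scope classical_set_scope.
Local Open Scope ring_scope.
Set Implicit Arguments.
Unset Strict Implicit.
Unset Printing Implicit Defensive.
Implicit Types (x z : 'rV[R]_n) (w : seq (step n)).

Let U : set 'rV[R]_n := arr_complement (catalan_arrangement c R).

Definition recentre x (i : 'I_n) : R := x ord0 i - (mhalf c i)%:R.

Definition word x : seq (step n) :=
  map (@mark n) (sort (relpre (key (recentre x)) <=%R) (points c)).

Lemma mhalf_double i : ((mhalf c i).*2 = c i + odd (c i))%N.
Proof. by rewrite /mhalf; case: ifP => oi; have := odd_double_half (c i); lia. Qed.

Lemma oneIE i : oneI c i = (odd (c i))%:Z.
Proof. by rewrite /oneI /oddI inE. Qed.

(** By c_i = 2 m_i - 1_I(i), the admissible k are those with -c_i <= k - (m_i - m_j) <= c_j, that is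
    k = m_i - m_j + t - s with 0 <= s <= c_i and 0 <= t <= c_j. *)
Lemma complementP x : U x <-> {in points c &, injective (key (recentre x))}.
Proof.
split=> [Ux [i s] [j t]|injx [_ [i [j [k [ij lek kle ->]]]]] /= xij].
  rewrite !mem_points /= => les let_ eqk.
  have [ij|ij] := eqVneq i j.
    move: eqk; rewrite ij /key /= => /addrI/eqP; rewrite eqr_nat => /eqP -> //.
  case: Ux; pose k : int := (mhalf c i)%:Z - (mhalf c j)%:Z + t%:Z - s%:Z.
  exists (hyperplane i j k).
    exists i, j, k; have := mhalf_double i; have := mhalf_double j.
    by rewrite !oneIE /k; split=> //; lia.
  move: eqk; rewrite /hyperplane /k /key /recentre /= !(intrB, intrD).
  by rewrite -!pmulrn => eqk; lra.
have := mhalf_double i; have := mhalf_double j; rewrite !oneIE in lek kle.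
(* [t] and [s] are the positive and negative parts of k - (m_i - m_j). *)
pose s := `|Num.max (0 : int) ((mhalf c i)%:Z - (mhalf c j)%:Z - k)%R|%N.
pose t := `|Num.max (0 : int) (k - (mhalf c i)%:Z + (mhalf c j)%:Z)%R|%N.
move=> mj mi; have /eqP := ij; apply.
have kE : k = (mhalf c i)%:Z - (mhalf c j)%:Z + t%:Z - s%:Z by rewrite /s /t; lia.
suff [-> //] : (i, s) = (j, t).
apply: injx; rewrite ?mem_points /=; [by rewrite /s; lia|by rewrite /t; lia|].
move: xij; rewrite /hyperplane kE /key /recentre /= !(intrB, intrD) -!pmulrn; lra.
Qed.

Lemma enumerates_word x : U x ->
  exists2 P, enumerates c (recentre x) P & word x = map (@mark n) P.
Proof. by move=> /complementP/enumerates_exists enP; eexists; first exact: enP. Qed.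

(** If two keys changed order within a connected subset of [U], their difference would vanish
    somewhere on it, by the intermediate value theorem. *)
Lemma same_component_order x z : connected_component U x z ->
  same_order c (recentre x) (recentre z).
Proof.
move=> [C [Cx CU Cconn] Cz].
have main u v p q : C u -> C v -> p \in points c -> q \in points c ->
    key (recentre u) p < key (recentre u) q -> key (recentre v) p < key (recentre v) q.
  move=> Cu Cv pP qP ltu; rewrite ltNge; apply/negP => lev.
  pose g (a : 'rV[R]_n) : R := key (recentre a) q - key (recentre a) p.
  have gcont : continuous g.
    have keyC r : continuous (fun a : 'rV[R]_n => key (recentre a) r).
      move=> a; have coordC := @coord_continuous R 1 n ord0 r.1 a.
      exact: (cvgD (cvgB coordC (cvg_cst _)) (cvg_cst _)).
    by move=> a; exact: (cvgB (keyC q a) (keyC p a)).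
  have /connected_intervalP ival : connected (g @` C).
    by apply: connected_continuous_connected => //; apply: continuous_subspaceT.
  have gv0u : g v <= 0 <= g u by rewrite /g subr_le0 lev subr_ge0 ltW.
  have [w Cw gw] := ival _ _ (imageP g Cv) (imageP g Cu) 0 gv0u.
  have /complementP injw := CU _ Cw.
  have pq : q = p by apply: injw => //; apply/eqP; rewrite -subr_eq0; apply/eqP.
  by move: ltu; rewrite pq ltxx.
by move=> p q pP qP; apply/idP/idP; apply: main.
Qed.

(** Keys are affine along the segment from [x] to [z], so an order shared by both ends holds
    throughout and the segment meets no hyperplane. *)
Lemma same_order_component x z : U x ->
  same_order c (recentre x) (recentre z) -> connected_component U x z.
Proof.
move=> Ux xz; pose g (t : R) : 'rV[R]_n := x + t *: (z - x).
exists (g @` `[0, 1]); last first.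
  by exists 1; rewrite /g /= ?in_itv /= ?ler01 ?lexx // scale1r addrC subrK.
split.
- by exists 0; rewrite /g /= ?in_itv /= ?ler01 ?lexx // scale0r addr0.
- move=> _ [t /= + <-]; rewrite in_itv /= => /andP[t0 t1].
  have injx := (complementP _).1 Ux; apply/complementP => p q pP qP eq_g.
  have keyE r : key (recentre (g t)) r =
      key (recentre x) r + t * (key (recentre z) r - key (recentre x) r).
    by rewrite /key /recentre /g !mxE; ring.
  have mono r r' : r \in points c -> r' \in points c ->
      key (recentre x) r < key (recentre x) r' ->
      key (recentre (g t)) r < key (recentre (g t)) r'.
    move=> rP rP' ltx; have := ltx; rewrite xz // => ltz; rewrite !keyE.
    move: ltx ltz; rewrite -subr_gt0 -[_ < key (recentre z) _]subr_gt0 => dx dz.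
    (* The difference of keys is (1 - t) times its value at [x] plus t times its value at [z]. For t
       < 1 the first term is positive; at t = 1 it vanishes and the second one decides. *)
    have [t_lt1|t_ge1] := ltP t 1; last first.
      have -> : t = 1 by apply/le_anti/andP.
      by lra.
    have dt : 0 < 1 - t by rewrite subr_gt0.
    by have := mulr_gt0 dt dx; have := mulr_ge0 t0 (ltW dz); lra.
  case: (ltgtP (key (recentre x) p) (key (recentre x) q)) => [/mono|/mono|/injx ->//].
    by rewrite eq_g ltxx => /(_ pP qP).
  by rewrite eq_g ltxx => /(_ qP pP).
apply: connected_continuous_connected; first exact: segment_connected.
apply: continuous_subspaceT => t; rewrite /g.
by apply: cvgD; [exact: cvg_cst|apply: cvgZl].
Qed.

Lemma word_eqP x z : U x -> U z ->
  word x = word z <-> connected_component U x z.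
Proof.
move=> Ux Uz; have [P enP ->] := enumerates_word Ux; have [Q enQ ->] := enumerates_word Uz.
split=> [eqm|/same_component_order xz].
  apply: same_order_component => //; have PQ := enumerates_mark_inj enP enQ eqm.
  by apply: (enumerates_same_order enP); rewrite PQ.
by rewrite (enumerates_eq (same_order_enumerates xz enP) enQ).
Qed.

Lemma word_dyck x : U x -> labelled_dyck_path c (word x).
Proof.
move=> Ux; have [P enP ->] := enumerates_word Ux.
by apply: dyck_of_perm => [|k]; [case: enP|apply: enumerates_pred_closed enP].
Qed.

Lemma word_surj w : labelled_dyck_path c w -> exists2 x, U x & word x = w.
Proof.
move=> /dyck_enumerated-/(_ R)[y [P [enP Pw]]].
(* Adding m_i undoes the recentring. *)
pose x : 'rV[R]_n := \row_i (y i + (mhalf c i)%:R).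
have xy : recentre x = y by apply/funext => i; rewrite /recentre mxE addrK.
have Ux : U x.
  apply/complementP; rewrite xy => p q pP qP.
  by apply: (key_inj_of_pairwise enP.2); rewrite (perm_mem enP.1).
exists x => //; have [Q] := enumerates_word Ux.
by rewrite xy => enQ ->; rewrite (enumerates_eq enQ enP).
Qed.

End Regions.

Theorem theorem2 (R : realType) (n : nat) (c : 'I_n -> nat)
    (n_ge1 : (1 <= n)%N) (c_gt0 : forall i : 'I_n, (0 < c i)%N) :
  exists f : set 'rV[R]_n -> seq (step n),
    set_bij (regions (catalan_arrangement c R)) (labelled_dyck_paths c) f.
Proof.
pose U := arr_complement (catalan_arrangement c R).
(* A chosen point of the region; the default 0 is returned only for the empty set, and a region is
   never empty. *)
pose repr A : 'rV[R]_n := xget 0%R A.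
have reprP x : U x -> connected_component U x (repr (connected_component U x)).
  by move=> Ux; apply: (xgetI 0%R (connected_component_refl Ux)).
have wordE x : U x -> word c (repr (connected_component U x)) = word c x.
  move=> Ux; have xr := reprP x Ux; symmetry; apply/word_eqP => //.
  exact: connected_component_sub xr.
exists (fun A => word c (repr A)); split=> [_ [x Ux <-]|A B|w /word_surj-/(_ R)[x Ux <-]].
- by rewrite /labelled_dyck_paths /= wordE //; apply: word_dyck.
- move=> /set_mem[x Ux <-] /set_mem[z Uz <-]; rewrite !wordE // => /word_eqP xz.
  by apply: same_connected_component; apply: xz.
by exists (connected_component U x); [exists x|rewrite wordE].
Qed.
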